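(* Let $\mathcal{H},\mathcal{K}$ be Hilbert spaces, let $\Phi_1,\ldots,\Phi_n:\mathcal{B}(\mathcal{H})\to\mathcal{B}(\mathcal{K})$ be positive linear mappings with $\sum_{i=1}^n\Phi_i(\mathbf{1}_{\mathcal{H}})=\mathbf{1}_{\mathcal{K}}$, let $A_1,\ldots,A_n,B_1,\ldots,B_n\in\mathcal{B}(\mathcal{H})$ be self-adjoint operators with spectra contained in the interval $J$, and let $f\in C^1_{\mathrm{co}}(J)$. Then $$f\left(\sum_{i=1}^n\Phi_i(B_i)\right)\le\sum_{i=1}^n\Phi_i(f(A_i))+\delta\,\mathbf{1}_{\mathcal{K}},$$ where $$\delta=\sup_{x\in\mathcal{K},\ \|x\|=1}\left\{\left\langle f'\left(\sum_{i=1}^n\Phi_i(B_i)\right)\sum_{i=1}^n\Phi_i(B_i)x,x\right\rangle-\left\langle\sum_{i=1}^n\Phi_i(A_i)x,x\right\rangle\left\langle f'\left(\sum_{i=1}^n\Phi_i(B_i)\right)x,x\right\rangle\right\}.$$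
   Context: $\mathcal{B}(\mathcal{H})$ is the $C^*$-algebra of bounded linear operators on a (complex) Hilbert space $\mathcal{H}$, with identity $\mathbf{1}_{\mathcal{H}}$. An operator $A$ is positive ($A\ge 0$) if $\langle Ax,x\rangle\ge 0$ for all $x\in\mathcal{H}$; for self-adjoint $A,B$, $A\le B$ means $B-A\ge 0$. A linear map $\Phi:\mathcal{B}(\mathcal{H})\to\mathcal{B}(\mathcal{K})$ is positive if $\Phi(A)\ge 0$ whenever $A\ge 0$. $C^1_{\mathrm{co}}(J)$ denotes the class of differentiable convex real functions on the interval $J\subseteq\mathbb{R}$ (one-sided derivatives at endpoints belonging to $J$); $f'$ is the derivative of $f$. For a self-adjoint operator $T$ with spectrum in $J$, $f(T)$ and $f'(T)$ are defined by the continuous functional calculus. *)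

(* Defs.v *)
From HB Require Import structures.
From mathcomp Require Import all_boot all_order all_algebra.
From mathcomp Require Import complex.
From mathcomp Require Import all_classical all_reals all_analysis.

Set Implicit Arguments.
Unset Strict Implicit.
Unset Printing Implicit Defensive.

Import Order.TTheory GRing.Theory Num.Theory.
Import numFieldNormedType.Exports.

Local Open Scope classical_set_scope.
Local Open Scope ring_scope.

(* Complex Hilbert spaces: complete normed spaces over R[i] whose norm comes
   from an inner product, linear in the first argument and conjugate-linear in
   the second.  The zero space is allowed. *)
HB.mixin Record CompleteNormedModule_isHilbert (R : realType) H
    of CompleteNormedModule R[i] H := {
  inner : {dot H for Num.conj};
  inner_norm : forall x : H, inner x x = `|x| ^+ 2
}.

#[short(type="hilbertType")]
HB.structure Definition Hilbert (R : realType) :=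
  {H of CompleteNormedModule R[i] H & CompleteNormedModule_isHilbert R H}.

Section BoundedOperators.
Context {R : realType} (H : hilbertType R).

Definition bounded_op : {pred H -> H} := fun T => `[< linear T /\
  exists M : R, forall x, `|T x| <= M%:C%C * `|x| >].

Record bop := Bop { bop_fun :> H -> H; _ : bop_fun \in bounded_op }.

HB.instance Definition _ := [isSub for bop_fun].
HB.instance Definition _ := [Choice of bop by <:].

Lemma bopP (T : bop) : linear T /\
  exists M : R, forall x, `|T x| <= M%:C%C * `|x|.
Proof. by case: T => T /= /asboolP. Qed.

Lemma bop_eqP (S T : bop) : S =1 T -> S = T.
Proof. by move=> ST; apply/val_inj/funext. Qed.

Fact bounded_op_submod : submod_closed bounded_op.
Proof.
split; first by apply/asboolP; split=> [a x y|];
  [rewrite scaler0 addr0 | exists 0 => x; rewrite normr0 mul0r].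
move=> a S T /asboolP[Slin [M SM]] /asboolP[Tlin [N TN]]; apply/asboolP; split.
  move=> b x y; rewrite !fctE Slin Tlin !scalerDr !scalerA (mulrC a).
  by rewrite addrACA.
exists (complex.Re `|a| * M + N) => x.
have aE : (complex.Re `|a|)%:C%C = `|a| by rewrite RRe_real ?normr_real.
rewrite fctE (le_trans (ler_normD _ _))// rmorphD rmorphM /= aE mulrDl lerD//.
by rewrite normrZ -mulrA ler_wpM2l.
Qed.

HB.instance Definition _ := GRing.isSubmodClosed.Build _ _ bounded_op
  bounded_op_submod.
HB.instance Definition _ :=
  [SubChoice_isSubLmodule of bop by <:].

Fact bounded_op_id : (@id H) \in bounded_op.
Proof. by apply/asboolP; split=> //; exists 1 => x; rewrite mul1r. Qed.

Fact bounded_op_comp (S T : bop) : (S \o T) \in bounded_op.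
Proof.
have [Slin [M SM]] := bopP S; have [Tlin [N TN]] := bopP T.
apply/asboolP; split=> [a x y|]; first by rewrite /= Tlin Slin.
exists (`|M| * N) => x; rewrite (le_trans (SM _))//.
rewrite (@le_trans _ _ (`|M|%:C%C * `|T x|))//.
  by rewrite ler_wpM2r// lecR ler_norm.
by rewrite rmorphM -mulrA ler_wpM2l// lecR.
Qed.

Definition bop1 : bop := Bop bounded_op_id.
Definition bop_mul (S T : bop) : bop := Bop (bounded_op_comp S T).

Fact bop_mulA : associative bop_mul. Proof. by move=> *; apply: bop_eqP. Qed.
Fact bop_mul1l : left_id bop1 bop_mul. Proof. by move=> *; apply: bop_eqP. Qed.
Fact bop_mul1r : right_id bop1 bop_mul. Proof. by move=> *; apply: bop_eqP. Qed.
Fact bop_mulDl : left_distributive bop_mul +%R.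
Proof. by move=> *; apply: bop_eqP. Qed.
Fact bop_mulDr : right_distributive bop_mul +%R.
Proof.
move=> S T U; apply: bop_eqP => x /=.
by have [Slin _] := bopP S; have := Slin 1 (T x) (U x); rewrite !scale1r.
Qed.

(* A pzRingType because B(H) is the zero ring when H = {0}. *)
HB.instance Definition _ := GRing.Zmodule_isPzRing.Build bop
  bop_mulA bop_mul1l bop_mul1r bop_mulDl bop_mulDr.

Definition selfadjoint (T : bop) := forall x y, inner (T x) y = inner x (T y).

(* 0 <= z in R[i] means that z is real and nonnegative. *)
Definition positive_op (T : bop) := forall x, 0 <= inner (T x) x.

Definition op_le (S T : bop) := positive_op (T - S).

Definition invertible_op (T : bop) := exists S : bop, S * T = 1 /\ T * S = 1.

Definition spectrum (T : bop) : set R[i] :=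
  [set z | ~ invertible_op (T - z *: (1 : bop))].

Definition spectrum_in (J : set R) (T : bop) :=
  spectrum T `<=` [set t%:C%C | t in J].

Definition op_poly (p : {poly R}) (T : bop) : bop :=
  \sum_(i < size p) (p`_i)%:C%C *: T ^+ i.

(* S is the operator-norm limit of p_k(T) for some real polynomials p_k that
   converge to g uniformly on the (real) spectrum of T. *)
Definition is_cfc (g : R -> R) (T S : bop) :=
  exists p : nat -> {poly R}, forall e : R, 0 < e -> \forall k \near \oo,
    (forall t, spectrum T t%:C%C -> `|(p k).[t] - g t| <= e) /\
    (forall x, `|op_poly (p k) T x - S x| <= e%:C%C * `|x|).

(* g(T) by the continuous functional calculus; meaningful when T is
   self-adjoint and g is continuous on its spectrum. *)
Definition cfc (g : R -> R) (T : bop) : bop := xget 0 [set S | is_cfc g T S].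

End BoundedOperators.

Definition positive_map (R : realType) (H K : hilbertType R)
    (Phi : bop H -> bop K) :=
  forall T, positive_op T -> positive_op (Phi T).

(* Differentiation relative to J: two-sided at interior points of J, one-sided
   at endpoints belonging to J. *)
Section DerivativeWithin.
Context {R : realType}.
Implicit Types (J : set R) (f : R -> R).

Definition diff_quotient f (x y : R) : R := (f y - f x) / (y - x).

Definition derivable_within J f x :=
  cvg (diff_quotient f x y @[y --> within J x^']).

Definition derive_within J f x : R :=
  lim (diff_quotient f x y @[y --> within J x^']).

Definition C1co J f :=
  convex_function (J : set (convex_lmodType R^o)) f /\
  forall x, J x -> derivable_within J f x.

End DerivativeWithin.

(* Main.v *)
(* Spectral positivity: if T is self-adjoint and a real polynomial p is
   nonnegative on the spectrum of T, then p(T) >= 0.  Indeed the infimum l of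
   the quadratic form of p(T) is an approximate eigenvalue of p(T); splitting
   p - l into complex linear factors, some T - z is not bounded below, so z is a
   real point of the spectrum with p(z) = l, and l >= 0.  Hence inequalities
   between functions on the spectrum pass to the functional calculus, which
   exists for continuous functions by Weierstrass approximation.

   Let x be a unit vector and t0 = <PA x, x>.  The supporting line of f at t0
   gives f(t0) <= sum_i <Phi_i(f(A_i)) x, x>.  On the spectrum of PB, the
   subgradient inequality f(s) + f'(s) (t0 - s) <= f(t0) gives
   <f(PB) x, x> <= f(t0) + <f'(PB) PB x, x> - t0 <f'(PB) x, x>, and the last two
   terms contribute at most delta.  If H or K is zero there is nothing to prove;
   otherwise all spectra lie in a segment [m, M] inside J. *)

Require Import Defs.
From HB Require Import structures.
From mathcomp Require Import all_boot all_order all_algebra.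
From mathcomp Require Import complex.
From mathcomp Require Import all_classical all_reals all_analysis.
From mathcomp Require Import ring lra.

Set Implicit Arguments.
Unset Strict Implicit.
Unset Printing Implicit Defensive.

Import Order.TTheory GRing.Theory Num.Theory.
Import numFieldNormedType.Exports.

Local Open Scope classical_set_scope.
Local Open Scope ring_scope.

(** Closes the approximation arguments, where the error is [e] times a fixed constant. In the choice
    [d / (C + 1)] the [+ 1] covers [C = 0]. *)
Lemma le_small_perturbation (R : realType) (r b C : R) : 0 <= C ->
  (forall e : R, 0 < e -> r <= b + e * C) -> r <= b.
Proof.
move=> C_ge0 r_le; apply/ler_addgt0Pr => d d_gt0.
rewrite (le_trans (r_le (d / (C + 1)) _)) ?divr_gt0 ?ltr_wpDl// lerD2l.
by rewrite mulrAC ler_pdivrMr ?ltr_wpDl// ler_wpM2l ?ltW// ltrDl.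
Qed.

(** * Real inner product *)

Section RealInnerProduct.
Context {R : realType} {H : hilbertType R}.
Implicit Types (x y z : H) (S T : bop H) (a b c : R).

HB.instance Definition _ T :=
  GRing.isLinear.Build R[i] H H *:%R (T : H -> H) (bopP T).1.

(** Estimates run in the ordered field [R]. Nothing is lost: the imaginary part of [inner x y] is
    [rin x ('i%C *: y)]. *)
Definition rin x y : R := complex.Re (inner x y).
Definition rnorm x : R := complex.Re `|x|.

Lemma rnormE x : (rnorm x)%:C%C = `|x|.
Proof. by rewrite /rnorm RRe_real ?ger0_real. Qed.

Lemma rnorm_ge0 x : 0 <= rnorm x.
Proof. by have := normr_ge0 x; rewrite -rnormE ler0c. Qed.

Lemma innerC x y : inner x y = (inner y x)^*.
Proof. by rewrite hermC expr0 mul1r. Qed.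

Lemma rinC x y : rin x y = rin y x.
Proof. by rewrite /rin innerC; case: (inner y x). Qed.

Lemma rinDl x y z : rin (x + y) z = rin x z + rin y z.
Proof. by rewrite /rin linearDl/= raddfD. Qed.

Lemma rinDr x y z : rin x (y + z) = rin x y + rin x z.
Proof. by rewrite rinC rinDl !(rinC x). Qed.

Lemma rinZl a x y : rin (a%:C%C *: x) y = a * rin x y.
Proof.
rewrite /rin linearZl_LR/=; case: (inner x y) => u v /=.
by rewrite mul0r subr0.
Qed.

Lemma rinZr a x y : rin x (a%:C%C *: y) = a * rin x y.
Proof. by rewrite rinC rinZl rinC. Qed.

Lemma rinNl x y : rin (- x) y = - rin x y.
Proof. by rewrite /rin linearNl/= raddfN. Qed.

Lemma rinNr x y : rin x (- y) = - rin x y.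
Proof. by rewrite rinC rinNl rinC. Qed.

Lemma rinBl x y z : rin (x - y) z = rin x z - rin y z.
Proof. by rewrite rinDl rinNl. Qed.

Lemma rinBr x y z : rin x (y - z) = rin x y - rin x z.
Proof. by rewrite rinDr rinNr. Qed.

Lemma rin0l x : rin 0 x = 0.
Proof. by rewrite /rin linear0l. Qed.

Lemma rin0r x : rin x 0 = 0.
Proof. by rewrite rinC rin0l. Qed.

Lemma rinxx x : rin x x = rnorm x ^+ 2.
Proof. by rewrite /rin inner_norm -rnormE -rmorphXn. Qed.

Lemma rin_i x y : rin x ('i%C *: y) = complex.Im (inner x y).
Proof.
rewrite /rin linearZr_LR/=; case: (inner x y) => u v /=.
by rewrite mul0r mulN1r opprK add0r.
Qed.

Lemma rin_il x y : rin ('i%C *: x) y = - rin x ('i%C *: y).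
Proof. by rewrite rinC !rin_i innerC; case: (inner x y). Qed.

Lemma rin_ii x y : rin ('i%C *: x) ('i%C *: y) = rin x y.
Proof.
by rewrite rin_il scalerA -expr2 sqr_i scaleN1r rinNr opprK.
Qed.

Lemma inner_eq x y x' y' : rin x y = rin x' y' ->
  rin x ('i%C *: y) = rin x' ('i%C *: y') -> inner x y = inner x' y'.
Proof.
rewrite !rin_i /rin; case: (inner x y) (inner x' y') => [u v] [u' v'] /=.
by move=> -> ->.
Qed.

End RealInnerProduct.

(** * Self-adjoint and positive operators, and lower bounds *)

Section BoundedOperatorTheory.
Context {R : realType} {H : hilbertType R}.
Implicit Types (x y z : H) (S T : bop H) (a b c e : R) (p q : {poly R}).

Lemma rnormD x y : rnorm (x + y) <= rnorm x + rnorm y.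
Proof. by rewrite -lecR rmorphD/= !rnormE ler_normD. Qed.

Lemma rnormB x y : rnorm (x - y) <= rnorm x + rnorm y.
Proof. by rewrite -lecR rmorphD/= !rnormE ler_normB. Qed.

Lemma rnormZ a x : rnorm (a%:C%C *: x) = `|a| * rnorm x.
Proof.
apply: complexI; rewrite rmorphM/= !rnormE normrZ; congr (_ * _).
by rewrite normc_def/= expr0n/= addr0 sqrtr_sqr.
Qed.

Lemma rnorm0 : rnorm (0 : H) = 0.
Proof. by rewrite /rnorm normr0. Qed.

Lemma rnorm_gt0 x : x != 0 -> 0 < rnorm x.
Proof. by rewrite -normr_gt0 -rnormE ltcR. Qed.

Lemma rnorm_le c x y : (rnorm x <= c * rnorm y) = (`|x| <= c%:C%C * `|y|).
Proof. by rewrite -!rnormE -rmorphM lecR. Qed.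

Lemma bop_bound T : exists2 M : R, 0 < M & forall x, rnorm (T x) <= M * rnorm x.
Proof.
have [_ [M TM]] := bopP T; exists (`|M| + 1); first by rewrite ltr_wpDl.
move=> x; have := TM x; rewrite -rnorm_le => /le_trans; apply.
by rewrite ler_wpM2r ?rnorm_ge0// ler_wpDr// ler_norm.
Qed.

Lemma bopDE S T x : (S + T) x = S x + T x. Proof. by []. Qed.
Lemma bopNE T x : (- T) x = - T x. Proof. by []. Qed.
Lemma bopBE S T x : (S - T) x = S x - T x. Proof. by []. Qed.
Lemma bopZE (u : R[i]) T x : (u *: T) x = u *: T x. Proof. by []. Qed.
Lemma bopME S T x : (S * T) x = S (T x). Proof. by []. Qed.
Lemma bop1E x : (1 : bop H) x = x. Proof. by []. Qed.
Lemma bop0E x : (0 : bop H) x = 0. Proof. by []. Qed.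

Lemma bop_scaleAl (u : R[i]) S T : u *: (S * T) = (u *: S) * T.
Proof. by apply: bop_eqP. Qed.

Lemma bop_scaleAr (u : R[i]) S T : u *: (S * T) = S * (u *: T).
Proof. by apply: bop_eqP => x; rewrite bopZE !bopME bopZE linearZ. Qed.

Lemma sa_rin T : selfadjoint T -> forall x y, rin (T x) y = rin x (T y).
Proof. by move=> Tsa x y; rewrite /rin Tsa. Qed.

Lemma rin_sa T : (forall x y, rin (T x) y = rin x (T y)) -> selfadjoint T.
Proof. by move=> Tsa x y; apply: inner_eq; rewrite Tsa // linearZ. Qed.

Lemma sa0 : selfadjoint (0 : bop H).
Proof. by apply: rin_sa => x y; rewrite !bop0E rin0l rin0r. Qed.

Lemma saD S T : selfadjoint S -> selfadjoint T -> selfadjoint (S + T).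
Proof.
by move=> Ssa Tsa; apply: rin_sa => x y; rewrite !bopDE rinDl rinDr !sa_rin.
Qed.

Lemma saN T : selfadjoint T -> selfadjoint (- T).
Proof. by move=> Tsa; apply: rin_sa => x y; rewrite !bopNE rinNl rinNr sa_rin. Qed.

Lemma saB S T : selfadjoint S -> selfadjoint T -> selfadjoint (S - T).
Proof. by move=> Ssa Tsa; apply/saD/saN. Qed.

Lemma saZ a T : selfadjoint T -> selfadjoint (a%:C%C *: T).
Proof. by move=> Tsa; apply: rin_sa => x y; rewrite !bopZE rinZl rinZr sa_rin. Qed.

Lemma sa_sum I (r : seq I) (P : pred I) (F : I -> bop H) :
  (forall i, P i -> selfadjoint (F i)) -> selfadjoint (\sum_(i <- r | P i) F i).
Proof. by move=> Fsa; apply: big_ind => //; [exact: sa0|exact: saD]. Qed.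

Lemma saX T n : selfadjoint T -> selfadjoint (T ^+ n).
Proof.
move=> Tsa; apply: rin_sa; elim: n => [|n IHn] x y; first by rewrite expr0.
by rewrite {1}exprS exprSr !bopME sa_rin// IHn.
Qed.

Lemma sa_op_poly p T : selfadjoint T -> selfadjoint (op_poly p T).
Proof. by move=> Tsa; apply: sa_sum => i _; apply/saZ/saX. Qed.

Lemma positive_opP T :
  selfadjoint T -> (forall x, 0 <= rin (T x) x) -> positive_op T.
Proof.
move=> Tsa T_ge0 x; have := T_ge0 x; rewrite /rin lecE /= => ->; rewrite andbT.
have /(congr1 (@complex.Im R)) := innerC (T x) x.
by rewrite -Tsa; case: (inner (T x) x) => u v /= vN; apply/eqP; lra.
Qed.

Lemma positive_op_ge0 T : positive_op T -> forall x, 0 <= rin (T x) x.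
Proof. by move=> T_ge0 x; have := T_ge0 x; rewrite lecE => /andP[]. Qed.

(** Polarization: the form is real at [x + 'i%C *: y], and the vanishing of its imaginary part is
    the symmetry of the cross terms. *)
Lemma positive_op_sa T : positive_op T -> selfadjoint T.
Proof.
move=> T_ge0.
have T_real x : complex.Im (inner (T x) x) = 0 by rewrite ger0_Im.
apply: rin_sa => x y; have := T_real (x + 'i%C *: y).
rewrite -rin_i linearD/= linearZ/= scalerDr scalerA -expr2 sqr_i scaleN1r.
rewrite !(rinDl, rinDr) !rinNr rin_ii rin_il rin_i T_real.
rewrite opprK rin_i T_real add0r addr0 (rinC (T y)) => /eqP.
by rewrite addrC subr_eq0 => /eqP.
Qed.

(** Its negation for [T - z] says that [z] is an approximate eigenvalue of [T]. *)
Definition bounded_below T :=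
  exists2 c : R, 0 < c & forall x, c * rnorm x <= rnorm (T x).

(** The form at [x + t y] is a nonnegative polynomial in [t] of degree at most 2. *)
Lemma psd_CauchySchwarz T : selfadjoint T -> (forall x, 0 <= rin (T x) x) ->
  forall x y, rin (T x) y ^+ 2 <= rin (T x) x * rin (T y) y.
Proof.
move=> Tsa T_ge0 x y.
set a := rin (T x) x; set b := rin (T x) y; set c := rin (T y) y.
have pos t : 0 <= a + 2 * b * t + c * t ^+ 2.
  have := T_ge0 (x + t%:C%C *: y).
  rewrite linearD/= linearZ/= !(rinDl, rinDr) !(rinZl, rinZr).
  rewrite (sa_rin Tsa y x) (rinC y) -/a -/b -/c; lra.
have [c0|c_neq0] := eqVneq c 0.
  have [->|b_neq0] := eqVneq b 0; first by rewrite c0 mulr0 expr0n.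
  (* With [c = 0] the polynomial is affine in [t], and its value at this point is -1. *)
  have := pos (- (a + 1) / (2 * b)); rewrite c0 mul0r addr0.
  have -> : 2 * b * (- (a + 1) / (2 * b)) = - (a + 1) by field.
  lra.
have c_gt0 : 0 < c by rewrite lt_def c_neq0/= T_ge0.
have := pos (- b / c).
have -> : a + 2 * b * (- b / c) + c * (- b / c) ^+ 2 = (a * c - b ^+ 2) / c.
  by field.
by rewrite pmulr_lge0 ?invr_gt0// subr_ge0.
Qed.

Lemma CauchySchwarz_rin x y : `|rin x y| <= rnorm x * rnorm y.
Proof.
rewrite -ler_sqr ?nnegrE ?mulr_ge0 ?rnorm_ge0// real_normK ?num_real//.
rewrite exprMn -!rinxx; apply: (@psd_CauchySchwarz 1) => // z.
by rewrite bop1E rinxx sqr_ge0.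
Qed.

Lemma bounded_belowM S T :
  bounded_below S -> bounded_below T -> bounded_below (S * T).
Proof.
move=> [c c0 cS] [d d0 dT]; exists (c * d) => [|x]; first exact: mulr_gt0.
by rewrite bopME (le_trans _ (cS _))// -mulrA ler_wpM2l// ltW.
Qed.

Lemma invertible_bounded_below T : invertible_op T -> bounded_below T.
Proof.
move=> [S [ST _]]; have [M M0 SM] := bop_bound S; exists M^-1 => [|x].
  by rewrite invr_gt0.
by rewrite ler_pdivrMl// (le_trans _ (SM _))// -bopME ST.
Qed.

(** The cross term of [T' x] and ['i%C *: x] vanishes, so the squared norm of [(T - z) x] is that of
    [T' x] plus [b ^+ 2] times that of [x]. *)
Lemma bounded_below_nonreal T (z : R[i]) :
  selfadjoint T -> complex.Im z != 0 -> bounded_below (T - z *: (1 : bop H)).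
Proof.
case: z => a b /= Tsa b0; exists `|b| => [|x]; first by rewrite normr_gt0.
rewrite -ler_sqr ?nnegrE ?mulr_ge0 ?rnorm_ge0// exprMn real_normK ?num_real//.
set T' := T - a%:C%C *: (1 : bop H); set y := b%:C%C *: ('i%C *: x).
have -> : (T - (a +i* b)%C *: (1 : bop H)) x = T' x - y.
  rewrite !bopBE !bopZE bop1E -addrA -opprD /y scalerA -scalerDl.
  by congr (_ - _ *: _); rewrite [LHS]complexE/= mulrC.
have T'sa : selfadjoint T' by apply/saB/saZ.
clearbody T'; rewrite -!rinxx rinBl !rinBr [rin y (T' x)]rinC !rinZr !rinZl rin_ii.
have -> : rin (T' x) ('i%C *: x) = 0.
  by have := sa_rin T'sa x ('i%C *: x); rewrite linearZ/= (rinC x) rin_il; lra.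
have := sqr_ge0 (rnorm (T' x)); rewrite -rinxx; lra.
Qed.

(** [l] is the infimum of the Rayleigh quotient. A lower bound [c] for [Q = S - l] would, by
    Cauchy-Schwarz for the form of [Q], keep the quotient of [Q] above [c ^+ 2 / N], contradicting
    the infimum. *)
Lemma exists_numrange_inf S : selfadjoint S -> (exists x : H, x != 0) ->
  exists2 l : R, forall x, l * rnorm x ^+ 2 <= rin (S x) x &
    ~ bounded_below (S - l%:C%C *: (1 : bop H)).
Proof.
move=> Ssa [x0 x0_neq0]; have [M M0 SM] := bop_bound S.
pose E := [set rin (S x) x / rnorm x ^+ 2 | x in [set x | x != 0]].
have E_inf : has_inf E.
  split; first by exists (rin (S x0) x0 / rnorm x0 ^+ 2), x0.
  exists (- M) => _ [x /= /rnorm_gt0 x_gt0 <-]; rewrite ler_pdivlMr ?exprn_gt0//.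
  have := CauchySchwarz_rin (S x) x; rewrite ler_norml => /andP[+ _].
  apply: le_trans; rewrite mulNr lerN2 expr2 mulrA ler_wpM2r ?rnorm_ge0//.
have l_le x : inf E * rnorm x ^+ 2 <= rin (S x) x.
  have [->|x_neq0] := eqVneq x 0; first by rewrite rnorm0 rin0r expr0n mulr0.
  rewrite -ler_pdivlMr ?exprn_gt0 ?rnorm_gt0//.
  by apply: ge_inf; [case: E_inf|exists x].
exists (inf E) => //; set Q := S - _ => -[c c0 cQ].
have [N N0 QN] := bop_bound Q.
have Qsa : selfadjoint Q by apply/saB/saZ.
have QE x : rin (Q x) x = rin (S x) x - inf E * rnorm x ^+ 2.
  by rewrite bopBE bopZE bop1E rinBl rinZl rinxx.
have Q_ge0 x : 0 <= rin (Q x) x by rewrite QE subr_ge0.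
have Q_sqr x : rnorm (Q x) ^+ 2 <= N * rin (Q x) x.
  have [->|/rnorm_gt0 y_gt0] := eqVneq (Q x) 0.
    by rewrite rnorm0 rin0l mulr0 expr0n.
  have := psd_CauchySchwarz Qsa Q_ge0 x (Q x); rewrite rinxx => cs.
  rewrite -(ler_pM2r (exprn_gt0 2 y_gt0)) -expr2 (le_trans cs)//.
  rewrite (mulrC N) -mulrA ler_wpM2l// (le_trans (ler_norm _))//.
  rewrite (le_trans (CauchySchwarz_rin _ _))// expr2 mulrA.
  by rewrite ler_wpM2r ?rnorm_ge0.
have e0 : 0 < c ^+ 2 / N by rewrite divr_gt0 ?exprn_gt0.
have [_ [x /= x_neq0 <-]] := inf_adherent e0 E_inf.
rewrite ltr_pdivrMr ?exprn_gt0 ?rnorm_gt0// mulrDl -ltrBlDl -QE.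
apply/negP; rewrite -leNgt mulrAC ler_pdivrMr// mulrC.
rewrite (mulrC _ N) (le_trans _ (Q_sqr x))//.
by rewrite mulrC -exprMn ler_sqr ?nnegrE ?mulr_ge0 ?rnorm_ge0// ltW.
Qed.

End BoundedOperatorTheory.

(** * Polynomial functional calculus *)

Section PolynomialCalculus.
Context {R : realType} {H : hilbertType R}.
Implicit Types (x : H) (S T : bop H) (a c e : R) (p q : {poly R}).

(** Complex coefficients allow a real polynomial to be split into linear factors before it is
    applied to [T]. *)
Definition cop_poly (P : {poly R[i]}) T : bop H :=
  \sum_(i < size P) P`_i *: T ^+ i.

Lemma cop_poly_wide n (P : {poly R[i]}) T : (size P <= n)%N ->
  cop_poly P T = \sum_(i < n) P`_i *: T ^+ i.
Proof.
move=> Pn; rewrite /cop_poly (big_ord_widen n (fun i => P`_i *: T ^+ i) Pn).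
rewrite big_mkcond; apply: eq_bigr => i _; case: ltnP => // iP.
by rewrite nth_default// scale0r.
Qed.

Lemma op_polyE p T : op_poly p T = cop_poly (map_poly (real_complex R) p) T.
Proof.
rewrite (@cop_poly_wide (size p)) ?size_poly//.
by apply: eq_bigr => i _; rewrite coef_map.
Qed.

Lemma cop_polyD P Q T : cop_poly (P + Q) T = cop_poly P T + cop_poly Q T.
Proof.
set n := maxn (size P) (size Q).
rewrite !(@cop_poly_wide n) ?size_polyD ?leq_maxl ?leq_maxr//.
by rewrite -big_split; apply: eq_bigr => i _; rewrite coefD scalerDl.
Qed.

Lemma cop_polyC (u : R[i]) T : cop_poly u%:P T = u *: (1 : bop H).
Proof.
rewrite (@cop_poly_wide 1) ?size_polyC ?leq_b1//.
by rewrite big_ord1 coefC expr0.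
Qed.

Lemma cop_polyMX P T : cop_poly (P * 'X) T = cop_poly P T * T.
Proof.
rewrite (@cop_poly_wide (size P).+1); last first.
  by rewrite (leq_trans (size_polyMleq _ _))// size_polyX addn2.
rewrite big_ord_recl coefMX/= scale0r add0r /cop_poly mulr_suml.
by apply: eq_bigr => i _; rewrite coefMX/= exprSr bop_scaleAl.
Qed.

Lemma cop_polyZ (u : R[i]) P T : cop_poly (u *: P) T = u *: cop_poly P T.
Proof.
rewrite (@cop_poly_wide (size P)) ?size_scale_leq//.
by rewrite scaler_sumr; apply: eq_bigr => i _; rewrite coefZ scalerA.
Qed.

Lemma cop_polyM P Q T : cop_poly (P * Q) T = cop_poly P T * cop_poly Q T.
Proof.
elim/poly_ind: Q => [|Q u IHQ].
  by rewrite mulr0 -[0]/(0%:P) cop_polyC scale0r mulr0.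
rewrite mulrDr mulrA !cop_polyD !cop_polyMX IHQ mulrDr mulrA; congr (_ + _).
by rewrite mulrC mul_polyC cop_polyZ cop_polyC -bop_scaleAr mulr1.
Qed.

Lemma op_polyD p q T : op_poly (p + q) T = op_poly p T + op_poly q T.
Proof. by rewrite !op_polyE rmorphD cop_polyD. Qed.

Lemma op_polyM p q T : op_poly (p * q) T = op_poly p T * op_poly q T.
Proof. by rewrite !op_polyE rmorphM cop_polyM. Qed.

Lemma op_polyC a T : op_poly a%:P T = a%:C%C *: (1 : bop H).
Proof. by rewrite op_polyE map_polyC cop_polyC. Qed.

Lemma op_polyZ a p T : op_poly (a *: p) T = a%:C%C *: op_poly p T.
Proof. by rewrite !op_polyE map_polyZ cop_polyZ. Qed.

Lemma op_polyN p T : op_poly (- p) T = - op_poly p T.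
Proof. by rewrite -scaleN1r op_polyZ rmorphN1 scaleN1r. Qed.

Lemma op_polyB p q T : op_poly (p - q) T = op_poly p T - op_poly q T.
Proof. by rewrite op_polyD op_polyN. Qed.

Lemma op_polyX T : op_poly 'X T = T.
Proof.
rewrite op_polyE map_polyX -['X]mul1r cop_polyMX -[1 : {poly R[i]}]/(1%:P).
by rewrite cop_polyC scale1r mul1r.
Qed.

Lemma bounded_below_scalar (u : R[i]) : u != 0 ->
  bounded_below (u *: (1 : bop H)).
Proof.
move=> u0; apply: invertible_bounded_below; exists (u^-1 *: (1 : bop H)).
split; apply: bop_eqP => x; rewrite bopME !bopZE !bop1E scalerA.
  by rewrite mulVf// scale1r.
by rewrite mulfV// scale1r.
Qed.

Lemma bounded_below_prod (s : seq R[i]) T :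
  (forall z, z \in s -> bounded_below (T - z *: (1 : bop H))) ->
  bounded_below (cop_poly (\prod_(z <- s) ('X - z%:P)) T).
Proof.
elim: s => [_|z s IHs sT].
  by rewrite big_nil -[1]/(1%:P) cop_polyC; apply: bounded_below_scalar.
rewrite big_cons cop_polyM; apply: bounded_belowM; last first.
  by apply: IHs => w ws; apply: sT; rewrite inE ws orbT.
have -> : cop_poly ('X - z%:P) T = T - z *: (1 : bop H).
  by rewrite -['X]mul1r -polyCN cop_polyD cop_polyMX -[1 : {poly R[i]}]/(1%:P)
    !cop_polyC scale1r mul1r scaleNr.
by apply: sT; rewrite inE eqxx.
Qed.

(* Either [p - l] is the zero polynomial, and any point of the spectrum works,
   or it splits over the complex numbers into factors [X - z] and one of the
   operators [T - z] is not bounded below. *)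
Lemma spectrum_op_poly p T l : selfadjoint T -> (exists x : H, x != 0) ->
  ~ bounded_below (op_poly p T - l%:C%C *: (1 : bop H)) ->
  exists2 t : R, spectrum T t%:C%C & p.[t] = l.
Proof.
move=> Tsa H_neq0 pT_l.
have in_spectrum t : ~ bounded_below (T - t%:C%C *: (1 : bop H)) -> spectrum T t%:C%C.
  by move=> Tt /invertible_bounded_below.
have [/eqP|pl_neq0] := eqVneq (p - l%:P) 0.
  rewrite subr_eq0 => /eqP ->.
  have [t _ /in_spectrum Tt] := exists_numrange_inf Tsa H_neq0.
  by exists t => //; rewrite hornerC.
set P := map_poly (real_complex R) (p - l%:P).
have [s Ps] := closed_field_poly_normal P.
have P_neq0 : P != 0 by rewrite map_poly_eq0.
have PT : cop_poly P T = op_poly p T - l%:C%C *: (1 : bop H).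
  by rewrite /P -op_polyE op_polyB op_polyC.
have /existsNP[z] : ~ forall z, z \in s -> bounded_below (T - z *: (1 : bop H)).
  move=> /bounded_below_prod sT; apply: pT_l; rewrite -PT Ps cop_polyZ.
  rewrite -[cop_poly _ _]mul1r bop_scaleAl; apply: bounded_belowM => //.
  by apply: bounded_below_scalar; rewrite lead_coef_eq0.
move=> /not_implyP[zs Tz].
(* A root off the real axis would leave [T - z] bounded below. *)
have z_real : complex.Im z = 0.
  by apply: contra_notP Tz => /eqP /(bounded_below_nonreal Tsa).
have zE : z = (complex.Re z)%:C%C by case: z z_real {zs Tz} => a b /= ->.
exists (complex.Re z); first by apply: in_spectrum; rewrite -zE.
have : root P z by rewrite Ps rootZ ?lead_coef_eq0// root_prod_XsubC.
rewrite zE /root horner_map/= => /eqP /complexI /eqP.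
by rewrite hornerD hornerN hornerC subr_eq0 => /eqP.
Qed.

Lemma op_poly_ge0 p T x : selfadjoint T ->
  (forall t, spectrum T t%:C%C -> 0 <= p.[t]) -> 0 <= rin (op_poly p T x) x.
Proof.
move=> Tsa p_ge0; have [->|x_neq0] := eqVneq x 0; first by rewrite rin0r.
have H_neq0 : exists x : H, x != 0 by exists x.
have [l l_le /(spectrum_op_poly Tsa H_neq0)[t /p_ge0 pt_ge0 ptl]] :=
  exists_numrange_inf (sa_op_poly p Tsa) H_neq0.
by rewrite (le_trans _ (l_le x))// mulr_ge0 ?sqr_ge0// -ptl.
Qed.

(** Spectral positivity of [e ^+ 2 - p ^+ 2], whose quadratic form is a difference of squared norms
    because [p(T)] is self-adjoint. *)
Lemma op_poly_bound p T e x : selfadjoint T -> 0 <= e ->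
  (forall t, spectrum T t%:C%C -> `|p.[t]| <= e) ->
  rnorm (op_poly p T x) <= e * rnorm x.
Proof.
move=> Tsa e_ge0 p_le.
rewrite -ler_sqr ?nnegrE ?mulr_ge0 ?rnorm_ge0//.
have : 0 <= rin (op_poly ((e ^+ 2)%:P - p * p) T x) x.
  apply: op_poly_ge0 => // t /p_le; rewrite hornerD hornerN hornerC hornerM.
  by rewrite subr_ge0 -expr2 -(real_normK (num_real p.[t])) ler_sqr ?nnegrE.
rewrite op_polyB op_polyM op_polyC bopBE bopZE bop1E bopME rinBl rinZl.
rewrite (sa_rin (sa_op_poly p Tsa)) !rinxx exprMn subr_ge0; exact.
Qed.

End PolynomialCalculus.

(** * Operator limits and existence of the functional calculus *)

Section OperatorLimits.
Context {R : realType} {H : hilbertType R}.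
Implicit Types (x : H) (S T : bop H) (a c e m M : R).

Lemma cauchy_rnorm_cvg (v : nat -> H) :
  (forall e, 0 < e -> exists N, forall i j, (N <= i)%N -> (N <= j)%N ->
     rnorm (v i - v j) <= e) -> cvg (v @ \oo).
Proof.
move=> v_cauchy; apply/cauchy_cvgP/cauchy_exP => e e_gt0.
(* Positivity in [R[i]] forces [e] to be real. *)
have [a a_gt0 ->] : exists2 a, 0 < a & e = a%:C%C.
  case: e e_gt0 => a b; rewrite ltcE/= => /andP[/eqP -> a_gt0].
  by exists a.
have [N vN] := v_cauchy (a / 2) ltac:(lra).
exists (v N); exists N => // i /= Ni; rewrite -ball_normE/= -rnormE ltcR.
by rewrite (le_lt_trans (vN _ _ _ _))// ltr_pdivrMr// ltr_pMr// ltr1n.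
Qed.

Lemma cvg_rnorm (v : nat -> H) x : v @ \oo --> x ->
  forall e, 0 < e -> exists N, forall i, (N <= i)%N -> rnorm (v i - x) <= e.
Proof.
move=> /cvgrPdist_lt vx e e_gt0.
have [|N _ vN] := vx e%:C%C; first by rewrite ltcR.
exists N => i /vN /=; rewrite -rnormE ltcR => /ltW.
by rewrite /rnorm distrC.
Qed.

(** The limit is taken pointwise; the Cauchy bound is uniform relative to the norm of the vector, so
    it survives in the limit and makes the limit bounded. *)
Lemma bop_complete (u : nat -> bop H) :
  (forall e, 0 < e -> exists N, forall i j, (N <= i)%N -> (N <= j)%N ->
     forall x, rnorm (u i x - u j x) <= e * rnorm x) ->
  exists S, forall e, 0 < e -> exists N, forall i, (N <= i)%N ->
     forall x, rnorm (u i x - S x) <= e * rnorm x.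
Proof.
move=> u_cauchy.
have u_cvg x : cvg (u i x @[i --> \oo]).
  apply: cauchy_rnorm_cvg => e e_gt0.
  have d_gt0 : 0 < e / (rnorm x + 1) by rewrite divr_gt0// ltr_wpDl// rnorm_ge0.
  have [N uN] := u_cauchy _ d_gt0; exists N => i j Ni Nj.
  rewrite (le_trans (uN _ _ Ni Nj x))// mulrAC ler_pdivrMr ?ltr_wpDl ?rnorm_ge0//.
  by rewrite ler_wpM2l ?ltW// ltrDl.
pose L x := lim (u i x @[i --> \oo]).
have uL e : 0 < e -> exists N, forall i, (N <= i)%N ->
    forall x, rnorm (u i x - L x) <= e * rnorm x.
  move=> e_gt0; have [N uN] := u_cauchy _ e_gt0; exists N => i Ni x.
  apply/ler_addgt0Pr => d d_gt0.
  have [N' uN'] := cvg_rnorm (u_cvg x) d_gt0.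
  (* The late index [j] depends on [x], but the resulting bound does not. *)
  set j := maxn N N'.
  have -> : u i x - L x = (u i x - u j x) + (u j x - L x) by rewrite addrA subrK.
  rewrite (le_trans (rnormD _ _))// lerD//; first by rewrite uN// leq_maxl.
  by rewrite uN' ?leq_maxr.
have L_lin : linear L.
  move=> a x y; apply: cvg_lim; first exact: norm_hausdorff.
  have -> : (fun i => u i (a *: x + y)) = (fun i => a *: u i x + u i y).
    by apply/funext => i; rewrite linearP.
  by apply: cvgD; [apply: cvgZr|]; apply: u_cvg.
have L_bounded : exists M : R, forall x, `|L x| <= M%:C%C * `|x|.
  have [N /(_ N (leqnn _)) uN] := uL 1 ltr01.
  have [M M_gt0 uM] := bop_bound (u N).
  exists (M + 1) => x; rewrite -rnorm_le.
  have -> : L x = u N x - (u N x - L x) by rewrite opprB addrC subrK.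
  by rewrite (le_trans (rnormB _ _))// mulrDl lerD.
have L_op : L \in @bounded_op R H by apply/asboolP.
by exists (Bop L_op).
Qed.

(** Cauchy-Schwarz at [x] and [T x], after cancelling the square of [rnorm (T x)]. *)
Lemma rin_le_bound T M x :
  selfadjoint T -> 0 <= M -> (forall x, 0 <= rin (T x) x) ->
  (forall x, rin (T x) x <= M * rnorm x ^+ 2) -> rnorm (T x) <= M * rnorm x.
Proof.
move=> Tsa M_ge0 T_ge0 T_le.
have [->|/rnorm_gt0 y_gt0] := eqVneq (T x) 0.
  by rewrite rnorm0 mulr_ge0 ?rnorm_ge0.
rewrite -ler_sqr ?nnegrE ?mulr_ge0 ?rnorm_ge0//.
have := psd_CauchySchwarz Tsa T_ge0 x (T x); rewrite rinxx => cs.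
rewrite -(ler_pM2r (exprn_gt0 2 y_gt0)) -expr2 (le_trans cs)//.
have -> : (M * rnorm x) ^+ 2 * rnorm (T x) ^+ 2 =
  (M * rnorm x ^+ 2) * (M * rnorm (T x) ^+ 2) by ring.
by rewrite ler_pM.
Qed.

(** The inverse is the limit of the geometric sums [u n], which are Cauchy by the telescoping
    identity [Tu] and the lower bound [T_below] on [1 - T]. *)
Lemma neumann_invertible T q : 0 <= q < 1 ->
  (forall x, rnorm (T x) <= q * rnorm x) -> invertible_op (1 - T).
Proof.
move=> /andP[q_ge0 q_lt1] Tq.
have Tn n x : rnorm ((T ^+ n) x) <= q ^+ n * rnorm x.
  elim: n => [|n IHn]; first by rewrite !expr0 mul1r.
  by rewrite !exprS bopME (le_trans (Tq _))// -mulrA ler_wpM2l.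
have q_small e : 0 < e -> exists N, forall i, (N <= i)%N -> q ^+ i <= e.
  move=> e_gt0; have /cvgrPdist_le/(_ e e_gt0)[N _ qN] : q ^+ n @[n --> \oo] --> 0.
    by apply: cvg_expr; rewrite ger0_norm.
  exists N => i /qN /=; rewrite sub0r normrN ger0_norm//; exact: exprn_ge0.
pose u n := \sum_(i < n) T ^+ i.
have Tu n x : (1 - T) (u n x) = x - (T ^+ n) x.
  have /(congr1 (fun S : bop H => S x)) := subrX1 T n.
  rewrite bopME !bopBE !bop1E -/(u n) => /(congr1 -%R).
  by rewrite !opprB.
have T_below x : (1 - q) * rnorm x <= rnorm ((1 - T) x).
  have := rnormD ((1 - T) x) (T x); rewrite bopBE bop1E subrK.
  by have := Tq x; lra.
have TB y z : (1 - T) (y - z) = (1 - T) y - (1 - T) z := linearB _ y z.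
have q1 : 0 < 1 - q by rewrite subr_gt0.
have [S uS] : exists S : bop H, forall e, 0 < e -> exists N,
    forall i, (N <= i)%N -> forall x, rnorm (u i x - S x) <= e * rnorm x.
  apply: bop_complete => e e_gt0.
  have [|N qN] := q_small ((1 - q) * (e / 2)).
    by rewrite mulr_gt0// divr_gt0.
  exists N => i j Ni Nj x.
  rewrite -(ler_pM2l q1) (le_trans (T_below _))// TB !Tu opprB addrC.
  rewrite addrA subrK (le_trans (rnormB _ _))//.
  rewrite (le_trans (lerD (Tn _ _) (Tn _ _)))// -mulrDl mulrA.
  rewrite ler_wpM2r ?rnorm_ge0//; have := qN _ Ni; have := qN _ Nj; lra.
have TS x : (1 - T) (S x) = x.
  apply/eqP; rewrite -subr_eq0; apply: contraT => /rnorm_gt0.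
  set y := _ - x => y_gt0.
  have [M M_gt0 TM] := bop_bound (1 - T).
  have C_ge0 : 0 <= M * rnorm x + rnorm x.
    by rewrite addr_ge0 ?mulr_ge0 ?rnorm_ge0// ltW.
  suff : rnorm y <= 0 by rewrite leNgt y_gt0.
  apply: (le_small_perturbation C_ge0) => e e_gt0; rewrite add0r.
  have [N uN] := uS _ e_gt0; have [N' qN'] := q_small _ e_gt0.
  set n := maxn N N'.
  have -> : y = - ((1 - T) (u n x - S x) + (T ^+ n) x).
    by rewrite TB Tu addrAC subrK opprB.
  rewrite {1}/rnorm normrN -/(rnorm _) (le_trans (rnormD _ _))// mulrDr lerD//.
    by rewrite (le_trans (TM _))// mulrCA ler_pM2l// uN// leq_maxl.
  by rewrite (le_trans (Tn _ _))// ler_wpM2r ?rnorm_ge0// qN'// leq_maxr.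
(* The right inverse [S] is also a left inverse because [T_below] makes [1 - T] injective. *)
exists S; split; apply: bop_eqP => x; rewrite bopME bop1E//.
have : rnorm ((1 - T) (S ((1 - T) x) - x)) = 0.
  by rewrite TB TS subrr rnorm0.
move=> y0; have := T_below (S ((1 - T) x) - x); rewrite y0 pmulr_rle0//.
move=> y_le0; apply/eqP; rewrite -subr_eq0; apply: contraT => /rnorm_gt0.
by rewrite ltNge y_le0.
Qed.

Lemma invertible_opZ (u : R[i]) T : u != 0 -> invertible_op T ->
  invertible_op (u *: T).
Proof.
move=> u0 [S [ST TS]]; exists (u^-1 *: S).
by rewrite -!bop_scaleAl -!bop_scaleAr ST TS !scalerA mulVf// mulfV// scale1r.
Qed.

(** Dividing [T] by [M] gives [1 - N], where [N] has norm at most [1 - M^-1 * c < 1]: a Neumann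
    series inverts it. *)
Lemma positive_definite_invertible T c : selfadjoint T -> 0 < c ->
  (forall x, c * rnorm x ^+ 2 <= rin (T x) x) -> invertible_op T.
Proof.
move=> Tsa c_gt0 T_ge; have [M0 M0_gt0 TM] := bop_bound T.
(* Adding [c] to the norm bound ensures [c <= M], so that [1 - M^-1 * c] is nonnegative. *)
pose M := M0 + c; have M_gt0 : 0 < M by rewrite addr_gt0.
pose N : bop H := 1 - M^-1%:C%C *: T.
have NE x : rin (N x) x = rnorm x ^+ 2 - M^-1 * rin (T x) x.
  by rewrite bopBE bopZE bop1E rinBl rinZl rinxx.
have T_le x : rin (T x) x <= M * rnorm x ^+ 2.
  rewrite (le_trans (ler_norm _))// (le_trans (CauchySchwarz_rin _ _))//.
  rewrite expr2 mulrA ler_wpM2r ?rnorm_ge0// (le_trans (TM _))//.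
  by rewrite ler_wpM2r ?rnorm_ge0// lerDl ltW.
have q_ge0 : 0 <= 1 - M^-1 * c.
  by rewrite subr_ge0 mulrC ler_pdivrMr// mul1r lerDr ltW.
have -> : T = M%:C%C *: (1 - N).
  rewrite /N opprB addrC subrK scalerA -rmorphM mulfV ?gt_eqF//.
  by rewrite rmorph1 scale1r.
apply: invertible_opZ.
  by rewrite -(rmorph0 (real_complex R)) (inj_eq (@complexI R)) gt_eqF.
apply: (@neumann_invertible _ (1 - M^-1 * c)).
  by rewrite q_ge0 ltrBlDr ltrDl mulr_gt0// invr_gt0.
move=> x; apply: rin_le_bound => //.
- by apply: saB => //; apply: saZ.
- by move=> z; rewrite NE subr_ge0 mulrC ler_pdivrMr// mulrC.
- move=> z; rewrite NE mulrBl mul1r lerD2l lerN2 -mulrA.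
  by rewrite ler_pM2l ?invr_gt0.
Qed.

(** The bounds [m <= T <= M] as quadratic forms, which unital positive maps transmit directly. *)
Definition numrange_in m M T :=
  forall x, m * rnorm x ^+ 2 <= rin (T x) x <= M * rnorm x ^+ 2.

(** For [t] outside [[m, M]], [T - t] or [t - T] is positive definite, hence invertible. *)
Lemma spectrum_numrange T m M t : selfadjoint T -> numrange_in m M T ->
  spectrum T t%:C%C -> m <= t <= M.
Proof.
move=> Tsa T_mM Tt; apply/andP; split; rewrite leNgt; apply/negP => t_lt;
    apply: Tt.
- have d_gt0 : 0 < m - t by rewrite subr_gt0.
  apply: (positive_definite_invertible _ d_gt0); first by apply/saB/saZ.
  move=> x; rewrite bopBE bopZE bop1E rinBl rinZl rinxx mulrBl lerD2r.
  by have /andP[] := T_mM x.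
- have -> : T - t%:C%C *: (1 : bop H) = (- 1) *: (t%:C%C *: (1 : bop H) - T).
    by rewrite scaleN1r opprB.
  apply: invertible_opZ; first by rewrite oppr_eq0 oner_eq0.
  have d_gt0 : 0 < t - M by rewrite subr_gt0.
  apply: (positive_definite_invertible _ d_gt0).
    by apply: saB => //; apply: saZ.
  move=> x; rewrite bopBE bopZE bop1E rinBl rinZl rinxx mulrBl lerD2l lerN2.
  by have /andP[] := T_mM x.
Qed.

(** The extreme values of the quadratic form are approximate eigenvalues, hence spectral points and
    elements of [J]; the upper one comes from [- T]. *)
Lemma spectrum_in_numrange (J : set R) T : selfadjoint T ->
  (exists x : H, x != 0) -> spectrum_in J T ->
  exists m M, [/\ J m, J M & numrange_in m M T].
Proof.
move=> Tsa H_neq0 TJ.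
have J_spec t : ~ bounded_below (T - t%:C%C *: (1 : bop H)) -> J t.
  move=> Tt; have /TJ[s Js /complexI <-//] : spectrum T t%:C%C.
  by move=> /invertible_bounded_below.
have [m m_le /J_spec Jm] := exists_numrange_inf Tsa H_neq0.
have [M' M'_le M'_inf] := exists_numrange_inf (saN Tsa) H_neq0.
exists m, (- M'); split=> //.
  apply: J_spec => -[c c_gt0 cT]; apply: M'_inf; exists c => // x.
  rewrite (le_trans (cT x))//.
  have -> : (T - (- M')%:C%C *: (1 : bop H)) x = - ((- T - M'%:C%C *: (1 : bop H)) x).
    by rewrite !bopBE !bopZE !bop1E !bopNE rmorphN scaleNr opprB !opprK addrC.
  by rewrite /rnorm normrN.
move=> x; rewrite m_le/=.
by have := M'_le x; rewrite bopNE rinNl mulNr lerNr.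
Qed.

(** [cfc] picks some operator satisfying [is_cfc], so it is enough to exhibit one: by
    [op_poly_bound] the operators [op_poly (p k) T] form a Cauchy sequence, and its limit serves. *)
Lemma cfcP g T m M (p : nat -> {poly R}) :
  selfadjoint T -> numrange_in m M T ->
  (forall e, 0 < e -> exists N, forall k, (N <= k)%N ->
     forall t, m <= t <= M -> `|(p k).[t] - g t| <= e) ->
  is_cfc g T (cfc g T).
Proof.
move=> Tsa T_mM pg; rewrite /cfc; case: xgetP => [S _ //|].
have [|S pS] := @bop_complete (fun k => op_poly (p k) T).
  move=> e e_gt0; have [|N pN] := pg (e / 2); first by rewrite divr_gt0.
  exists N => i j Ni Nj x; rewrite -bopBE -op_polyB.
  apply: op_poly_bound => //; first exact: ltW.
  move=> t /(spectrum_numrange Tsa T_mM) t_mM.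
  rewrite hornerD hornerN -(subrKA (g t)).
  rewrite (le_trans (ler_normD _ _))// [leRHS]splitr lerD ?pN//.
  by rewrite distrC pN.
move=> /(_ S) []; exists p => e e_gt0.
have [N pN] := pg e e_gt0; have [N' pN'] := pS e e_gt0.
exists (maxn N N') => // k /=; rewrite geq_max => /andP[Nk N'k]; split.
  by move=> t /(spectrum_numrange Tsa T_mM); apply: pN.
by move=> x; rewrite -rnorm_le; apply: pN'.
Qed.

End OperatorLimits.

(** * Weierstrass approximation *)

Section Weierstrass.
Context {R : realType}.
Implicit Types (phi psi : nat -> R) (n : nat) (x y m M e : R).

(* Bernstein operator, defined through Pascal's rule: at [x] in [0, 1] it gives
   the expectation of [phi] under the binomial law of parameters [n] and [x]. *)
Fixpoint bernstein n phi : {poly R} :=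
  if n is n'.+1 then
    (1 - 'X) * bernstein n' phi + 'X * bernstein n' (fun i => phi i.+1)
  else (phi 0)%:P.

Lemma bernsteinS n phi x : (bernstein n.+1 phi).[x] =
  (1 - x) * (bernstein n phi).[x] + x * (bernstein n (fun i => phi i.+1)).[x].
Proof. by rewrite /= !hornerE. Qed.

Lemma bernstein_affine n a b phi x : (bernstein n (fun i => a + b * phi i)).[x] =
  a + b * (bernstein n phi).[x].
Proof.
elim: n phi => [|n IHn] phi; first by rewrite /= !hornerE.
by rewrite !bernsteinS !IHn; ring.
Qed.

Lemma bernstein_le n phi psi x : 0 <= x <= 1 ->
  (forall i, (i <= n)%N -> phi i <= psi i) ->
  (bernstein n phi).[x] <= (bernstein n psi).[x].
Proof.
move=> /andP[x_ge0 x_le1]; elim: n phi psi => [|n IHn] phi psi phi_psi.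
  by rewrite /= !hornerE phi_psi.
rewrite !bernsteinS lerD// ler_wpM2l ?subr_ge0 ?IHn// => i i_n.
  by rewrite phi_psi// (leq_trans i_n).
by rewrite phi_psi.
Qed.

(** Variance plus squared bias: the binomial law has mean [n%:R * x] and variance
    [n%:R * x * (1 - x)]. *)
Lemma bernstein_sqr n (c : R) x :
  (bernstein n (fun i => (i%:R - c) ^+ 2)).[x] =
  n%:R * x * (1 - x) + (n%:R * x - c) ^+ 2.
Proof.
elim: n c => [|n IHn] c; first by rewrite /= !hornerE; ring.
rewrite bernsteinS IHn.
have -> : (fun i => (i.+1%:R - c) ^+ 2) = (fun i : nat => (i%:R - (c - 1)) ^+ 2).
  by apply/funext => i; rewrite -natr1; ring.
by rewrite IHn -natr1; ring.
Qed.

(* Uniform continuity and boundedness on [m, M], in the form in which the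
   variance of the binomial law controls the Bernstein polynomials. *)
Definition quadratic_modulus m M (g : R -> R) :=
  forall e, 0 < e -> exists2 C, 0 <= C &
    forall s t, m <= s <= M -> m <= t <= M -> `|g s - g t| <= e + C * (s - t) ^+ 2.

(** The modulus traps [g] at the nodes between two quadratics centred at [t]. The Bernstein operator
    is monotone and turns the quadratic term into a variance, at most [D / k.+1%:R] after
    rescaling. *)
Lemma weierstrass_approximation m M (g : R -> R) : quadratic_modulus m M g ->
  exists p : nat -> {poly R}, forall e, 0 < e -> exists N, forall k, (N <= k)%N ->
    forall t, m <= t <= M -> `|(p k).[t] - g t| <= e.
Proof.
move=> g_mod; pose node k i : R := m + (M - m) * (i%:R / k.+1%:R).
pose p k := bernstein k.+1 (g \o node k) \Po ((M - m)^-1 *: ('X - m%:P)).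
exists p => e e_gt0; have [|C C_ge0 gC] := g_mod (e / 2); first by rewrite divr_gt0.
pose D := C * (M - m) ^+ 2.
have D_ge0 : 0 <= D by rewrite mulr_ge0 ?sqr_ge0.
exists (Num.bound (D / (e / 2))) => k Nk t t_mM.
have Dk : D / k.+1%:R <= e / 2.
  rewrite ler_pdivrMr ?ltr0n// mulrC -ler_pdivrMr ?divr_gt0//.
  rewrite (le_trans (ltW (archi_boundP _)))//; first by rewrite divr_ge0// ltW// divr_gt0.
  by rewrite ler_nat (leq_trans Nk).
pose x := (t - m) / (M - m).
(* If [M = m], the inverse of zero is zero, so [x] is 0 and [t] is [m]. *)
have tE : t = m + (M - m) * x.
  have [Mm|Mm] := eqVneq M m; last by rewrite /x; field; rewrite subr_eq0.
  by rewrite Mm subrr mul0r addr0; apply/le_anti; rewrite andbC -[X in t <= X]Mm.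
have x01 : 0 <= x <= 1.
  have [Mm|Mm] := eqVneq M m; first by rewrite /x Mm subrr invr0 mulr0 lexx ler01.
  have Mm_gt0 : 0 < M - m.
    by rewrite subr_gt0 lt_def Mm/=; case/andP: t_mM; apply: le_trans.
  case/andP: t_mM => mt tM; apply/andP; split.
    by rewrite /x divr_ge0 ?(ltW Mm_gt0)// subr_ge0.
  by rewrite /x ler_pdivrMr// mul1r lerD2r.
have pE : (p k).[t] = (bernstein k.+1 (g \o node k)).[x].
  by rewrite /p horner_comp hornerZ hornerXsubC /x mulrC.
have node_mM i : (i <= k.+1)%N -> m <= node k i <= M.
  move=> ik; have m_M : 0 <= M - m.
    by rewrite subr_ge0; case/andP: t_mM; apply: le_trans.
  rewrite /node lerDl mulr_ge0 ?divr_ge0//= -lerBrDl ler_piMr//.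
  by rewrite ler_pdivrMr ?ltr0n// mul1r ler_nat.
have node_dist i : (node k i - t) ^+ 2 =
    (M - m) ^+ 2 / k.+1%:R ^+ 2 * (i%:R - k.+1%:R * x) ^+ 2.
  by rewrite {1}tE /node; field; rewrite addrC natr1 pnatr_eq0.
pose psi i : R := (i%:R - k.+1%:R * x) ^+ 2.
have psiE : (bernstein k.+1 psi).[x] = k.+1%:R * x * (1 - x).
  by rewrite bernstein_sqr subrr expr0n addr0.
pose B := D / k.+1%:R ^+ 2.
have B_le : B * (bernstein k.+1 psi).[x] <= e / 2.
  rewrite psiE (le_trans _ Dk)//.
  have -> : B * (k.+1%:R * x * (1 - x)) = D / k.+1%:R * (x * (1 - x)).
    by rewrite /B; field; rewrite addrC natr1 pnatr_eq0.
  rewrite ler_piMr ?divr_ge0//; case/andP: x01 => x0 x1.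
  by rewrite mulr_ile1 ?subr_ge0// lerBlDr lerDl.
have bound i : (i <= k.+1)%N -> `|g (node k i) - g t| <= e / 2 + B * psi i.
  move=> /node_mM node_i; rewrite (le_trans (gC _ _ node_i t_mM))//.
  by rewrite node_dist lerD2l /B /D /psi !mulrA.
rewrite pE ler_norml; apply/andP; split.
- rewrite lerBrDl.
  have : (bernstein k.+1 (fun i => (g t - e / 2) + - B * psi i)).[x] <=
      (bernstein k.+1 (g \o node k)).[x].
    apply: bernstein_le => // i /bound; rewrite ler_norml => /andP[+ _] /=.
    by lra.
  rewrite bernstein_affine; lra.
- have : (bernstein k.+1 (g \o node k)).[x] <=
      (bernstein k.+1 (fun i => (g t + e / 2) + B * psi i)).[x].
    apply: bernstein_le => // i /bound; rewrite ler_norml => /andP[_ +] /=.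
    by lra.
  rewrite bernstein_affine; lra.
Qed.

End Weierstrass.

(** * Differentiable convex functions *)

Section DifferentiableConvex.
Context {R : realType}.
Implicit Types (J : set R) (f g : R -> R) (s t m M e : R).

(** Clearing the denominator admits [t = s], which the deleted neighbourhood leaves out. *)
Lemma derive_withinP J f s : derivable_within J f s ->
  forall e, 0 < e -> exists2 d, 0 < d & forall t, J t -> `|t - s| < d ->
    `|f t - f s - derive_within J f s * (t - s)| <= e * `|t - s|.
Proof.
move=> f_der e e_gt0; have /cvgrPdist_le/(_ e e_gt0) := f_der.
rewrite near_withinE near_withinE => /nbhs_ballP[d /= d_gt0 dJ].
exists d => // t Jt ts; have [->|t_neq] := eqVneq t s.
  by rewrite !subrr mulr0 subrr normr0 mulr0.
have := dJ t; rewrite -ball_normE/= distrC => /(_ ts t_neq Jt).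
have ts_neq0 : t - s != 0 by rewrite subr_eq0.
rewrite -/(derive_within J f s) distrC /diff_quotient => q_le.
have -> : f t - f s - derive_within J f s * (t - s) =
    ((f t - f s) / (t - s) - derive_within J f s) * (t - s) by field.
by rewrite normrM ler_wpM2r.
Qed.

(** At a point [y] of the segment close to [s], the chord bounds [f y] above and differentiability
    bounds it below; dividing by [l] leaves an error proportional to [e]. *)
Lemma convex_subgradient J f s t : is_interval J -> C1co J f -> J s -> J t ->
  f s + derive_within J f s * (t - s) <= f t.
Proof.
move=> J_itv [f_conv f_der] Js Jt.
have [->|ts] := eqVneq t s; first by rewrite subrr mulr0 addr0.
have ts_gt0 : 0 < `|t - s| by rewrite normr_gt0 subr_eq0.
rewrite -lerBrDl; apply: (le_small_perturbation (normr_ge0 (t - s))) => e e_gt0.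
have [d d_gt0 dJ] := derive_withinP (f_der s Js) e_gt0.
(* Keeps [y] between [s] and [t], and at most [d / 2] away from [s]. *)
pose l := Num.min 1 (d / (2 * `|t - s|)).
have l_gt0 : 0 < l by rewrite lt_min ltr01 divr_gt0// mulr_gt0.
have l_le1 : l <= 1 by rewrite ge_min lexx.
pose y := s + l * (t - s).
have Jy : J y.
  have [s_t|t_s] := leP s t.
    apply: (J_itv s t) => //; apply/andP; split; rewrite /y; nra.
  apply: (J_itv t s) => //; apply/andP; split; rewrite /y; nra.
have yE : y - s = l * (t - s) by rewrite /y addrC addKr.
have y_s : `|y - s| < d.
  rewrite yE normrM gtr0_norm// (@le_lt_trans _ _ (d / 2))//; last by lra.
  have -> : d / 2 = d / (2 * `|t - s|) * `|t - s| by field; rewrite gt_eqF.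
  by rewrite ler_pM2r// ge_min lexx orbT.
have fy_ge : f s + derive_within J f s * (y - s) - e * `|y - s| <= f y.
  by have := dJ y Jy y_s; rewrite ler_norml => /andP[+ _]; lra.
have fy_le : f y <= l * f t + (1 - l) * f s.
  have : f (l * t + (1 - l) * s) <= l * f t + (1 - l) * f s :=
    f_conv (Itv01 (ltW l_gt0) l_le1) t s (mem_set Jt) (mem_set Js).
  by have -> : l * t + (1 - l) * s = y by rewrite /y; ring.
rewrite -(ler_pM2l l_gt0).
have nyE : `|y - s| = l * `|t - s| by rewrite yE normrM gtr0_norm.
by move: fy_ge; rewrite nyE yE; lra.
Qed.

(* A differentiable convex function on [m, M], presented by its derivative [g]
   through the subgradient inequality. *)
Section Segment.
Variables (m M : R) (f g : R -> R).
Hypothesis f_sub : forall s t, m <= s <= M -> m <= t <= M ->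
  f s + g s * (t - s) <= f t.

(** Add the subgradient inequalities from [s] to [t] and from [t] to [s]. *)
Lemma subgradient_mono s t : m <= s <= M -> m <= t <= M -> s <= t -> g s <= g t.
Proof.
move=> s_mM t_mM; rewrite le_eqVlt => /orP[/eqP -> //|s_t].
have := f_sub s_mM t_mM; have := f_sub t_mM s_mM.
by move=> H1 H2; rewrite -subr_ge0 -(pmulr_lge0 _ (_ : 0 < t - s)) ?subr_gt0//; lra.
Qed.

(** Monotonicity bounds [g] by [L], a Lipschitz constant of [f]; completing a square turns the
    linear bound into a quadratic one. *)
Lemma subgradient_modulus : quadratic_modulus m M f.
Proof.
move=> e e_gt0; pose L := `|g m| + `|g M|.
exists (L ^+ 2 / (4 * e)); first by rewrite divr_ge0 ?sqr_ge0 ?mulr_ge0 ?ltW.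
have gL s : m <= s <= M -> `|g s| <= L.
  move=> s_mM; have /andP[ms sM] := s_mM; have mM := le_trans ms sM.
  have m_mM : m <= m <= M by rewrite lexx.
  have M_mM : m <= M <= M by rewrite mM lexx.
  have := subgradient_mono m_mM s_mM ms; have := subgradient_mono s_mM M_mM sM.
  move=> gsM gms; rewrite ler_norml /L.
  have := ler_norm (g M); have := ler_norm (- g m); rewrite normrN.
  have := normr_ge0 (g M); have := normr_ge0 (g m).
  by move=> *; apply/andP; split; lra.
have f_le s t : m <= s <= M -> m <= t <= M -> f s - f t <= L * `|s - t|.
  move=> s_mM t_mM; have := f_sub s_mM t_mM.
  have := ler_norm (g s * (s - t)); rewrite normrM.
  have := ler_wpM2r (normr_ge0 (s - t)) (gL s s_mM); lra.
move=> s t s_mM t_mM; apply: (@le_trans _ _ (L * `|s - t|)).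
  rewrite ler_norml lerNl opprB f_le// andbT distrC; exact: f_le.
rewrite -(real_normK (num_real (s - t))); set a := `|s - t|.
have : 0 <= (2 * e - L * a) ^+ 2 / (4 * e).
  by rewrite divr_ge0 ?sqr_ge0 ?mulr_ge0 ?ltW.
have -> : (2 * e - L * a) ^+ 2 / (4 * e) = e + L ^+ 2 / (4 * e) * a ^+ 2 - L * a.
  by field; rewrite gt_eqF.
lra.
Qed.

Hypothesis f_dif : forall s, m <= s <= M -> forall e, 0 < e ->
  exists2 d, 0 < d & forall t, m <= t <= M -> `|t - s| < d ->
    `|f t - f s - g s * (t - s)| <= e * `|t - s|.

(* Compare the subgradient inequality at [y] with the expansion of [f] at [s],
   both taken at the reflection [2 y - s] of [s] about [y]. *)
Lemma subgradient_continuous s : m <= s <= M -> forall e, 0 < e ->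
  exists2 d, 0 < d & forall y, m <= y <= M -> `|y - s| < d -> `|g y - g s| <= e.
Proof.
move=> s_mM e e_gt0; have [|d d_gt0 fd] := f_dif s_mM (e := e / 2).
  by rewrite divr_gt0.
(* The radius keeps the reflected point in [[m, M]]. If [s] is an endpoint, [y] is already on its
   inner side, and 1 does for that end. *)
have [r r_gt0 refl] : exists2 r, 0 < r & forall y, m <= y <= M -> `|y - s| < r ->
    m <= 2 * y - s <= M.
  have /andP[ms sM] := s_mM.
  exists (Num.min (if m < s then (s - m) / 2 else 1)
                  (if s < M then (M - s) / 2 else 1)).
    by rewrite lt_min; apply/andP; split; case: ifP => // *; lra.
  move=> y y_mM; rewrite lt_min ltr_norml ltr_norml.
  by case: (ltP m s) => ?; case: (ltP s M) => ?; lra.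
exists (Num.min (d / 2) r); first by rewrite lt_min r_gt0 divr_gt0.
move=> y y_mM; rewrite lt_min => /andP[y_d /(refl y y_mM) z_mM].
have [->|y_s] := eqVneq y s; first by rewrite subrr normr0 ltW.
set z := 2 * y - s in z_mM.
have zE : `|z - s| = 2 * `|y - s|.
  have -> : z - s = 2 * (y - s) by rewrite /z; ring.
  by rewrite normrM gtr0_norm.
have fz : `|f z - f s - g s * (z - s)| <= e / 2 * `|z - s|.
  by apply: fd => //; rewrite zE; lra.
have fy := f_sub y_mM z_mM; have fs := f_sub s_mM y_mM.
have mono : 0 <= (g y - g s) * (y - s).
  by have := f_sub y_mM s_mM; lra.
have : (g y - g s) * (y - s) <= e * `|y - s|.
  have := ler_norml; move: fz; rewrite ler_norml zE => /andP[_ fz] _.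
  by rewrite /z in fz fy; lra.
rewrite -{1}(ger0_norm mono) normrM ler_pM2r// normr_gt0 subr_eq0//.
Qed.

(** Compactness makes the continuity of [g] uniform, which handles close points; for points at least
    [d] apart, the total increase [D] of [g] is at most [D / d ^+ 2 * (s - t) ^+ 2]. *)
Lemma derivative_modulus : quadratic_modulus m M g.
Proof.
move=> e e_gt0; pose D := `|g M - g m|.
have [d d_gt0 gd] : exists2 d, 0 < d & forall s t, m <= s <= M -> m <= t <= M ->
    `|s - t| < d -> `|g s - g t| <= e.
  pose P d s := forall t, m <= s <= M -> m <= t <= M ->
    `|s - t| < d -> `|g s - g t| <= e.
  have : \forall d \near 0^'+, `[m, M] `<=` P d.
    have /compact_near_coveringP := @segment_compact R m M; apply.
    move=> s; rewrite /= in_itv/= => s_mM.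
    have [|d d_gt0 gd] := subgradient_continuous s_mM (e := e / 2).
      by rewrite divr_gt0.
    (* With half the radius, [s'] and any [t] within [r] of [s'] both lie within [d] of [s]. *)
    exists (ball s (d / 2), [set r | r < d / 2]).
      split=> /=; first by apply: nbhsx_ballx; rewrite divr_gt0.
      by apply: nbhs_right_lt; rewrite divr_gt0.
    move=> [s' r] /= [s's r_d] t s'_mM t_mM s't.
    move: s's; rewrite -ball_normE/= distrC => s's.
    rewrite -(subrKA (g s)) (le_trans (ler_normD _ _))// [leRHS]splitr lerD//.
      by apply: gd => //; lra.
    rewrite distrC; apply: gd => //.
    rewrite -(subrKA s') (le_lt_trans (ler_normD _ _))// distrC.
    lra.
  move=> /(filterI (nbhs_right_gt 0))/filter_ex[d [d_gt0 dP]].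
  by exists d => // s t s_mM; apply: dP.
exists (D / d ^+ 2); first by rewrite divr_ge0 ?sqr_ge0 ?normr_ge0.
move=> s t s_mM t_mM; have [st_d|d_st] := ltP `|s - t| d.
  by rewrite (le_trans (gd s t s_mM t_mM st_d))// lerDl mulr_ge0 ?sqr_ge0
    ?divr_ge0 ?sqr_ge0 ?normr_ge0.
have /andP[ms sM] := s_mM; have /andP[mt tM] := t_mM.
have mM := le_trans ms sM.
have m_mM : m <= m <= M by rewrite lexx.
have M_mM : m <= M <= M by rewrite mM lexx.
have gst : `|g s - g t| <= D.
  have := subgradient_mono m_mM s_mM ms; have := subgradient_mono s_mM M_mM sM.
  have := subgradient_mono m_mM t_mM mt; have := subgradient_mono t_mM M_mM tM.
  have := ler_norm (g M - g m); rewrite -/D => *.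
  by rewrite ler_norml; apply/andP; split; lra.
rewrite (le_trans gst)// -[X in X <= _]add0r lerD ?(ltW e_gt0)//.
rewrite mulrAC ler_pdivlMr ?exprn_gt0// ler_wpM2l ?normr_ge0//.
by rewrite -(real_normK (num_real (s - t))) ler_sqr ?nnegrE ?(ltW d_gt0).
Qed.

End Segment.
End DifferentiableConvex.

(** * Inequalities between functions of an operator *)

Section ContinuousCalculus.
Context {R : realType} {H : hilbertType R}.
Implicit Types (x : H) (S T F G : bop H) (u v w : {poly R}) (f g : R -> R).

Lemma is_cfc_approx f T S e : is_cfc f T S -> 0 < e ->
  exists2 p : {poly R}, forall t, spectrum T t%:C%C -> `|p.[t] - f t| <= e &
    forall x, rnorm (op_poly p T x - S x) <= e * rnorm x.
Proof.
move=> [p pf] e_gt0; have [N _ /(_ N (leqnn N)) [pf1 pf2]] := pf e e_gt0.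
by exists (p N) => // x; rewrite rnorm_le.
Qed.

(** The polynomial approximants are self-adjoint, so the asymmetry of [S] is at most [e * C] for
    every positive [e]. *)
Lemma is_cfc_selfadjoint f T S : selfadjoint T -> is_cfc f T S -> selfadjoint S.
Proof.
move=> Tsa TS; apply: rin_sa => x y; apply/eqP.
rewrite -subr_eq0 -normr_le0; set C := rnorm x * rnorm y + rnorm x * rnorm y.
have C_ge0 : 0 <= C by rewrite addr_ge0 ?mulr_ge0 ?rnorm_ge0.
apply: (le_small_perturbation C_ge0) => e e_gt0; rewrite add0r.
have [p _ pS] := is_cfc_approx TS e_gt0.
have -> : rin (S x) y - rin x (S y) =
    rin x (op_poly p T y - S y) - rin (op_poly p T x - S x) y.
  by rewrite rinBr rinBl (sa_rin (sa_op_poly p Tsa)); ring.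
rewrite (le_trans (ler_normB _ _))// mulrDr lerD//.
  rewrite (le_trans (CauchySchwarz_rin _ _))// mulrCA.
  by rewrite ler_wpM2l ?rnorm_ge0.
rewrite (le_trans (CauchySchwarz_rin _ _))// mulrA.
by rewrite ler_wpM2r ?rnorm_ge0.
Qed.

(** Serves both the supporting line and the tangent inequality. With [f] and [g] replaced by
    polynomials, spectral positivity applies once a constant of order [e] is added to absorb the
    error. *)
Lemma cfc_combination_ge0 u v w f g T F G (C : R) :
  selfadjoint T -> is_cfc f T F -> is_cfc g T G ->
  (forall t, spectrum T t%:C%C -> `|u.[t]| + `|v.[t]| <= C) ->
  (forall t, spectrum T t%:C%C -> 0 <= f t * u.[t] + g t * v.[t] + w.[t]) ->
  forall x, 0 <= rin ((F * op_poly u T + G * op_poly v T + op_poly w T) x) x.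
Proof.
move=> Tsa TF TG uvC fg_ge0 x; rewrite -oppr_le0.
pose ux := op_poly u T x; pose vx := op_poly v T x.
(* The absolute value covers an empty spectrum, where nothing fixes the sign of [C]. *)
pose D := `|C| * rnorm x ^+ 2 + (rnorm ux + rnorm vx) * rnorm x.
have D_ge0 : 0 <= D.
  by rewrite addr_ge0 ?mulr_ge0 ?sqr_ge0 ?addr_ge0 ?rnorm_ge0.
apply: (le_small_perturbation D_ge0) => e e_gt0; rewrite add0r.
have [p pf pF] := is_cfc_approx TF e_gt0.
have [q qg qG] := is_cfc_approx TG e_gt0.
have := @op_poly_ge0 _ _ (p * u + q * v + w + (e * `|C|)%:P) T x Tsa.
rewrite !op_polyD !op_polyM op_polyC => /(_ _)/wrap[].
  move=> t Tt; rewrite !hornerD !hornerM hornerC.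
  have err : `|(p.[t] - f t) * u.[t] + (q.[t] - g t) * v.[t]| <= e * `|C|.
    rewrite (le_trans (ler_normD _ _))// !normrM.
    apply: (@le_trans _ _ (e * (`|u.[t]| + `|v.[t]|))).
      by rewrite mulrDr lerD// ler_wpM2r// ?pf ?qg.
    by rewrite ler_pM2l// (le_trans (uvC t Tt))// ler_norm.
  have := fg_ge0 t Tt; move: err; rewrite ler_norml => /andP[+ _]; lra.
rewrite !bopDE !bopME bopZE bop1E -/ux -/vx !rinDl rinZl rinxx => pq_ge0.
have errF : rin (op_poly p T ux - F ux) x <= e * rnorm ux * rnorm x.
  rewrite (le_trans (ler_norm _))// (le_trans (CauchySchwarz_rin _ _))//.
  by rewrite ler_wpM2r ?rnorm_ge0.
have errG : rin (op_poly q T vx - G vx) x <= e * rnorm vx * rnorm x.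
  rewrite (le_trans (ler_norm _))// (le_trans (CauchySchwarz_rin _ _))//.
  by rewrite ler_wpM2r ?rnorm_ge0.
move: errF errG; rewrite !rinBl /D; lra.
Qed.

Lemma sa_innerE T x : selfadjoint T -> inner (T x) x = (rin (T x) x)%:C%C.
Proof.
move=> Tsa; have /(congr1 (@complex.Im R)) := innerC (T x) x.
rewrite -Tsa /rin; case: (inner (T x) x) => a b /= bN.
by congr (_ +i* _)%C; lra.
Qed.

Lemma rin_sum I (r : seq I) (P : pred I) (E : I -> bop H) x :
  rin ((\sum_(i <- r | P i) E i) x) x = \sum_(i <- r | P i) rin (E i x) x.
Proof.
apply: (big_morph (fun T : bop H => rin (T x) x)) => [S T|].
  by rewrite bopDE rinDl.
by rewrite bop0E rin0l.
Qed.

(** The extreme bounds over a finite nonempty family are attained, so they remain in [J]. *)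
Lemma common_numrange (J : set R) (I : finType) (i0 : I) (E : I -> bop H) :
  (exists x : H, x != 0) -> (forall i, selfadjoint (E i)) ->
  (forall i, spectrum_in J (E i)) ->
  exists m M, [/\ J m, J M & forall i, numrange_in m M (E i)].
Proof.
move=> H_neq0 Esa EJ.
have /choice[b bE] : forall i, exists b : R * R,
    [/\ J b.1, J b.2 & numrange_in b.1 b.2 (E i)].
  move=> i; have [m [M mM]] := spectrum_in_numrange (Esa i) H_neq0 (EJ i).
  by exists (m, M).
have [im _ im_le] := arg_minP (fun i => (b i).1) (erefl : xpredT i0).
have [iM _ iM_ge] := arg_maxP (fun i => (b i).2) (erefl : xpredT i0).
exists (b im).1, (b iM).2; split; first by case: (bE im).
  by case: (bE iM).
move=> i x; have [_ _ /(_ x) /andP[m_le M_ge]] := bE i.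
rewrite (le_trans _ m_le) ?(le_trans M_ge) ?ler_wpM2r ?sqr_ge0 ?im_le//.
exact: iM_ge.
Qed.

End ContinuousCalculus.

(** * Positive linear maps *)

Section PositiveMaps.
Context {R : realType} {H K : hilbertType R}.

(** [T] is the difference of the positive operators [T + c] and [c], whose images are positive,
    hence self-adjoint. *)
Lemma positive_map_sa (Phi : {linear bop H -> bop K}) T :
  positive_map Phi -> selfadjoint T -> selfadjoint (Phi T).
Proof.
move=> Phi_pos Tsa; have [M M_gt0 TM] := bop_bound T.
pose c : bop H := M%:C%C *: (1 : bop H).
have csa : selfadjoint c by apply: saZ.
have cE x : rin (c x) x = M * rnorm x ^+ 2 by rewrite bopZE bop1E rinZl rinxx.
have -> : Phi T = Phi (T + c) - Phi c by rewrite linearD addrK.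
apply: saB; apply/positive_op_sa/Phi_pos/positive_opP => //.
- exact: saD.
- move=> x; rewrite bopDE rinDl cE -lerBlDr sub0r.
  have := CauchySchwarz_rin (T x) x; rewrite ler_norml => /andP[+ _].
  apply: le_trans; rewrite lerN2 expr2 mulrA ler_wpM2r ?rnorm_ge0//.
- by move=> x; rewrite cE mulr_ge0 ?sqr_ge0// ltW.
Qed.

Lemma positive_map_sum_le n (Phi : 'I_n -> {linear bop H -> bop K})
    (S T : 'I_n -> bop H) :
  (forall i, positive_map (Phi i)) ->
  (forall i, selfadjoint (S i)) -> (forall i, selfadjoint (T i)) ->
  (forall i x, rin (S i x) x <= rin (T i x) x) ->
  forall y, rin ((\sum_(i < n) Phi i (S i)) y) y <=
            rin ((\sum_(i < n) Phi i (T i)) y) y.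
Proof.
move=> Phi_pos Ssa Tsa ST y; rewrite !rin_sum; apply: ler_sum => i _.
have /(Phi_pos i)/positive_op_ge0/(_ y) : positive_op (T i - S i).
  apply: positive_opP; first exact: saB.
  by move=> x; rewrite bopBE rinBl subr_ge0.
by rewrite linearB bopBE rinBl subr_ge0.
Qed.

End PositiveMaps.

Theorem corollary2p1 (R : realType) (H K : hilbertType R) (n : nat)
    (Phi : 'I_n -> {linear bop H -> bop K})
    (Phi_pos : forall i, positive_map (Phi i))
    (Phi_unital : \sum_(i < n) Phi i 1 = 1)
    (J : set R) (J_itv : is_interval J)
    (A B : 'I_n -> bop H)
    (A_sa : forall i, selfadjoint (A i)) (B_sa : forall i, selfadjoint (B i))
    (A_J : forall i, spectrum_in J (A i)) (B_J : forall i, spectrum_in J (B i))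
    (f : R -> R) (f_C1co : C1co J f) :
  let PA := \sum_(i < n) Phi i (A i) in
  let PB := \sum_(i < n) Phi i (B i) in
  let f'PB := cfc (derive_within J f) PB in
  let delta : R :=
    sup [set complex.Re (inner ((f'PB * PB) x) x
                 - inner (PA x) x * inner (f'PB x) x)
        | x in [set x : K | `|x| = 1]] in
  op_le (cfc f PB) (\sum_(i < n) Phi i (cfc f (A i)) + delta%:C%C *: (1 : bop K)).
Proof.
move=> PA PB f'PB delta.
have [K_neq0|K0] := pselect (exists z : K, z != 0); last first.
  move=> x; have -> : x = 0.
    by apply/eqP; apply: contraT => x_neq0; case: K0; exists x.
  by rewrite linear0r.
have [z z_neq0] := K_neq0.
(* If [H] were zero, [1 = 0] in [bop H] and unitality would make [K] zero as well. *)
have H_neq0 : exists x : H, x != 0.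
  apply: contrapT => H0; move/eqP: z_neq0; apply.
  rewrite -[z]bop1E -Phi_unital big1 ?bop0E// => i _.
  have -> : (1 : bop H) = 0.
    apply: bop_eqP => x; rewrite bop1E bop0E.
    by apply/eqP; apply: contraT => x_neq0; case: H0; exists x.
  by rewrite linear0.
have [i0] : exists i : 'I_n, True.
  case: n Phi Phi_unital {Phi_pos A B A_sa B_sa A_J B_J PA PB f'PB delta}
    => [|n] Phi Phi_unital; last by exists ord0.
  move/eqP: z_neq0; case.
  by rewrite -[z]bop1E -Phi_unital big_ord0 bop0E.
move=> _.
(* Joining both tuples in one family yields a single segment for all the operators. *)
pose E (s : 'I_n + 'I_n) := match s with inl i => A i | inr i => B i end.
have [m [M [Jm JM E_mM]]] : exists m M,
    [/\ J m, J M & forall s, numrange_in m M (E s)].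
  by apply: (common_numrange (inl i0)) => //; case.
have A_mM i : numrange_in m M (A i) := E_mM (inl i).
have B_mM i : numrange_in m M (B i) := E_mM (inr i).
have J_mM t : m <= t <= M -> J t by apply: J_itv.
(* By unitality scalars are reproduced, so the bounds [m] and [M] pass to [PA] and [PB]. *)
have scalar_sum (a : R) (y : K) :
    rin ((\sum_(i < n) Phi i (a%:C%C *: (1 : bop H))) y) y = a * rnorm y ^+ 2.
  have -> : \sum_(i < n) Phi i (a%:C%C *: (1 : bop H)) = a%:C%C *: (1 : bop K).
    by rewrite -Phi_unital scaler_sumr; apply: eq_bigr => i _; rewrite linearZ.
  by rewrite bopZE bop1E rinZl rinxx.
have scalar_rin (a : R) (x : H) :
    rin ((a%:C%C *: (1 : bop H)) x) x = a * rnorm x ^+ 2.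
  by rewrite bopZE bop1E rinZl rinxx.
have numrange_sum (T : 'I_n -> bop H) : (forall i, selfadjoint (T i)) ->
    (forall i, numrange_in m M (T i)) ->
    numrange_in m M (\sum_(i < n) Phi i (T i)).
  move=> Tsa T_mM y; rewrite -!scalar_sum; apply/andP.
  split; apply: positive_map_sum_le => // [i|i x];
    by [apply: saZ | rewrite scalar_rin; case/andP: (T_mM i x)].
have PA_mM : numrange_in m M PA by apply: numrange_sum.
have PB_mM : numrange_in m M PB by apply: numrange_sum.
have PA_sa : selfadjoint PA by apply: sa_sum => i _; apply: positive_map_sa.
have PB_sa : selfadjoint PB by apply: sa_sum => i _; apply: positive_map_sa.
pose g := derive_within J f.
have f_sub s t : m <= s <= M -> m <= t <= M -> f s + g s * (t - s) <= f t.
  by move=> /J_mM Js /J_mM Jt; apply: convex_subgradient.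
have f_dif s : m <= s <= M -> forall e, 0 < e -> exists2 d, 0 < d &
    forall t, m <= t <= M -> `|t - s| < d ->
      `|f t - f s - g s * (t - s)| <= e * `|t - s|.
  move=> /J_mM Js e e_gt0.
  have [d d_gt0 dJ] := derive_withinP (f_C1co.2 s Js) e_gt0.
  by exists d => // t /J_mM; apply: dJ.
have [pf pfP] := weierstrass_approximation (subgradient_modulus f_sub).
have [pg pgP] := weierstrass_approximation (derivative_modulus f_sub f_dif).
have f_cfc (L : hilbertType R) (T : bop L) : selfadjoint T ->
    numrange_in m M T -> is_cfc f T (cfc f T).
  by move=> Tsa T_mM; apply: (cfcP Tsa T_mM pfP).
have fA_cfc i : is_cfc f (A i) (cfc f (A i)) by apply: f_cfc.
have fB_cfc : is_cfc f PB (cfc f PB) by apply: f_cfc.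
have gB_cfc : is_cfc g PB f'PB := cfcP PB_sa PB_mM pgP.
have fA_sa i : selfadjoint (cfc f (A i)) := is_cfc_selfadjoint (A_sa i) (fA_cfc i).
have fB_sa : selfadjoint (cfc f PB) := is_cfc_selfadjoint PB_sa fB_cfc.
rewrite /op_le; set D := _ - cfc f PB.
have D_sa : selfadjoint D.
  apply: saB => //; apply: saD; last exact: saZ.
  by apply: sa_sum => i _; apply: positive_map_sa.
have D_ge0 (y : K) : `|y| = 1 -> 0 <= rin (D y) y.
  move=> y1; have ny : rnorm y = 1 by rewrite /rnorm y1.
  pose t0 := rin (PA y) y.
  have t0_mM : m <= t0 <= M by have := PA_mM y; rewrite ny expr1n !mulr1.
  (* Jensen's inequality, from the supporting line of [f] at [t0]. *)
  have jensen : f t0 <= rin ((\sum_(i < n) Phi i (cfc f (A i))) y) y.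
    pose l : {poly R} := (g t0)%:P * ('X - t0%:P) + (f t0)%:P.
    have lA i : op_poly l (A i) =
        (g t0)%:C%C *: A i + (f t0 - g t0 * t0)%:C%C *: (1 : bop H).
      rewrite /l op_polyD mul_polyC op_polyZ op_polyB op_polyX !op_polyC.
      rewrite scalerBr scalerA -addrA -scaleNr -scalerDl.
      by congr (_ + _ *: _); rewrite rmorphB rmorphM addrC.
    (* Being affine, [l] commutes with the unital sum of the maps, and its value at [t0] is
       [f t0]. *)
    have -> : f t0 = rin ((\sum_(i < n) Phi i (op_poly l (A i))) y) y.
      have -> : \sum_(i < n) Phi i (op_poly l (A i)) =
          (g t0)%:C%C *: PA + (f t0 - g t0 * t0)%:C%C *: (1 : bop K).
        rewrite /PA -Phi_unital !scaler_sumr -big_split; apply: eq_bigr => i _.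
        by rewrite lA linearD !linearZ.
      rewrite bopDE !bopZE bop1E rinDl !rinZl rinxx ny -/t0; ring.
    apply: positive_map_sum_le => // [i|i x]; first exact: sa_op_poly.
    have := @cfc_combination_ge0 _ _ 1%:P 0%:P (- l) f f _ _ _ (1 + 0)
      (A_sa i) (fA_cfc i) (fA_cfc i) _ _ x.
    rewrite !op_polyC op_polyN rmorph1 rmorph0 scale0r scale1r mulr0 !addr0 mulr1.
    rewrite bopBE rinBl subr_ge0; apply=> t tA.
      by rewrite !hornerC normr1 normr0.
    have t_mM := spectrum_numrange (A_sa i) (A_mM i) tA.
    have := f_sub _ _ t0_mM t_mM; rewrite /l !hornerE; lra.
  (* The subgradient inequality from a spectral point [t] to [t0], with polynomial coefficients
     [-1], ['X - t0] and [f t0]; the constant [1 + (M - m)] bounds the first two. *)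
  have tangent : rin (cfc f PB y) y <=
      f t0 + rin ((f'PB * PB) y) y - t0 * rin (f'PB y) y.
    have := @cfc_combination_ge0 _ _ (-1)%:P ('X - t0%:P) (f t0)%:P f g _ _ _
      (1 + (M - m)) PB_sa fB_cfc gB_cfc _ _ y.
    rewrite !op_polyC op_polyB op_polyX op_polyC (rmorphN1 (real_complex R)) scaleN1r mulrN1.
    rewrite mulrBr -bop_scaleAr mulr1 !bopDE !bopNE !bopZE bop1E.
    rewrite !rinDl !rinNl !rinZl rinxx ny => tangent_ge0.
    suff : 0 <= - rin (cfc f PB y) y + (rin ((f'PB * PB) y) y -
      t0 * rin (f'PB y) y) + f t0 * 1 ^+ 2 by lra.
    apply: tangent_ge0 => t tB; have t_mM := spectrum_numrange PB_sa PB_mM tB.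
      rewrite hornerXsubC hornerC normrN1 lerD2l ler_norml.
      by case/andP: t_mM; case/andP: t0_mM; lra.
    by have := f_sub _ _ t_mM t0_mM; rewrite hornerXsubC !hornerC; lra.
  have gap : rin ((f'PB * PB) y) y - t0 * rin (f'PB y) y <= delta.
    (* [inner (PA x) x] is real, so the real part passes through the product. *)
    have valE (x : K) : complex.Re (inner ((f'PB * PB) x) x -
          inner (PA x) x * inner (f'PB x) x) =
        rin ((f'PB * PB) x) x - rin (PA x) x * rin (f'PB x) x.
      rewrite (sa_innerE x PA_sa) raddfB /rin; congr (_ - _).
      by case: (inner (f'PB x) x) => a b /=; rewrite mul0r subr0.
    (* The supremum dominates the value at [y] once the set is bounded above, which Cauchy-Schwarz
       gives on unit vectors. *)
    apply: ub_le_sup; last by exists y; rewrite // valE.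
    have [N1 _ N1P] := bop_bound (f'PB * PB).
    have [N2 N2_gt0 N2P] := bop_bound PA.
    have [N3 _ N3P] := bop_bound f'PB.
    exists (N1 + N2 * N3) => _ [x /= x1 <-]; rewrite valE.
    have nx : rnorm x = 1 by rewrite /rnorm x1.
    have rin_le (T : bop K) N : (forall x, rnorm (T x) <= N * rnorm x) ->
        `|rin (T x) x| <= N.
      move=> TN; rewrite (le_trans (CauchySchwarz_rin _ _))// nx mulr1.
      by rewrite (le_trans (TN _))// nx mulr1.
    rewrite (le_trans (ler_norm _))// (le_trans (ler_normB _ _))//.
    by rewrite lerD ?rin_le// normrM ler_pM ?normr_ge0 ?rin_le.
  rewrite bopBE bopDE bopZE bop1E rinBl rinDl rinZl rinxx ny expr1n mulr1.
  lra.
apply: positive_opP => // x.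
have [->|x_neq0] := eqVneq x 0; first by rewrite rin0r.
have nx : rnorm x != 0 by rewrite gt_eqF ?rnorm_gt0.
(* The quadratic form scales by the square of the norm, so unit vectors suffice. *)
pose y := (rnorm x)^-1%:C%C *: x.
have -> : x = (rnorm x)%:C%C *: y.
  by rewrite scalerA -rmorphM mulfV// rmorph1 scale1r.
rewrite linearZ rinZl rinZr mulrA mulr_ge0 ?mulr_ge0 ?rnorm_ge0//.
apply: D_ge0; rewrite -rnormE rnormZ ger0_norm ?invr_ge0 ?rnorm_ge0//.
by rewrite mulVf.
Qed.
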